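(* Let $M>m>0$ and let $f,g,h\in L^2_\phi(\Omega)$, with $h(x)\ne 0$ for almost every $x\in\Omega$, be such that the functions $$M\cdot\frac{g}{h}-\frac{f}{h},\qquad \frac{f}{h}-m\cdot\frac{g}{h}$$ are synchronous. Then $$0\le\left|\begin{matrix}\int_\Omega\phi f^2&\int_\Omega\phi fh\\ \int_\Omega\phi fh&\int_\Omega\phi h^2\end{matrix}\right|^{1/2}+\left|\begin{matrix}\int_\Omega\phi g^2&\int_\Omega\phi gh\\ \int_\Omega\phi gh&\int_\Omega\phi h^2\end{matrix}\right|^{1/2}-\left|\begin{matrix}\int_\Omega\phi (f+g)^2&\int_\Omega\phi (f+g)h\\ \int_\Omega\phi (f+g)h&\int_\Omega\phi h^2\end{matrix}\right|^{1/2}\le\frac{\sqrt M-\sqrt m}{(mM)^{1/4}}\left|\begin{matrix}\int_\Omega\phi fg&\int_\Omega\phi fh\\ \int_\Omega\phi gh&\int_\Omega\phi h^2\end{matrix}\right|^{1/2} .$$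
   Context: $(\Omega,\Sigma,\mu)$ is a measure space consisting of a set $\Omega$, a $\sigma$-algebra $\Sigma$ of subsets of $\Omega$ and a countably additive positive measure $\mu$ on $\Sigma$ with values in $\mathbb{R}\cup\{\infty\}$; $\phi:\Omega\to[0,\infty)$ is a measurable function. $L^2_\phi(\Omega)$ denotes the Hilbert space of all real-valued measurable functions $f$ on $\Omega$ with $\int_\Omega\phi(s)|f(s)|^2\,d\mu(s)<\infty$. $\int_\Omega\phi fg$ abbreviates $\int_\Omega\phi(x)f(x)g(x)\,d\mu(x)$ (and similarly for the other integrals), and vertical bars around an array denote the determinant. A pair of real-valued functions $(q,p)$ on $\Omega$ is called synchronous if $(q(x)-q(y))(p(x)-p(y))\ge0$ for almost every $x,y\in\Omega$ (i.e. for $\mu$-almost every $x$, the inequality holds for $\mu$-almost every $y$). *)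

(* Defs.v *)
From HB Require Import structures.
From mathcomp Require Import all_boot all_order all_algebra.
From mathcomp Require Import all_classical all_reals all_analysis.

Set Implicit Arguments.
Unset Strict Implicit.
Unset Printing Implicit Defensive.

Import Order.TTheory GRing.Theory Num.Theory.
Import numFieldNormedType.Exports.

Local Open Scope classical_set_scope.
Local Open Scope ring_scope.

(* Membership in L^2_phi is a property of functions, not of classes modulo
   almost everywhere equality. *)
Definition L2weight (R : realType) (d : measure_display) (T : measurableType d)
    (mu : {measure set T -> \bar R}) (phi f : T -> R) : Prop :=
  measurable_fun [set: T] f /\
  (\int[mu]_(s in [set: T]) (phi s * `|f s| ^+ 2)%:E < +oo)%E.

(* The two quantifiers are iterated: for mu-almost every x, the inequality
   holds for mu-almost every y; no product measure is involved. *)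
Definition synchronous (R : realType) (d : measure_display)
    (T : measurableType d) (mu : {measure set T -> \bar R}) (q p : T -> R) :
    Prop :=
  {ae mu, forall x, {ae mu, forall y, 0 <= (q x - q y) * (p x - p y)}}.

Definition wint (R : realType) (d : measure_display) (T : measurableType d)
    (mu : {measure set T -> \bar R}) (phi f g : T -> R) : R :=
  \int[mu]_(x in [set: T]) (phi x * f x * g x).

Definition det22 (R : realType) (a b c d : R) : R :=
  \det (\matrix_(i < 2, j < 2) (nth [::] [:: [:: a; b]; [:: c; d]] i)`_j).

(* Main.v *)
Require Import Defs.
From HB Require Import structures.
From mathcomp Require Import all_boot all_order all_algebra.
From mathcomp Require Import all_classical all_reals all_analysis.
From mathcomp Require Import measurable_realfun ring lra.

Set Implicit Arguments.
Unset Strict Implicit.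
Unset Printing Implicit Defensive.

Import Order.TTheory GRing.Theory Num.Theory.
Import numFieldNormedType.Exports.

Local Open Scope classical_set_scope.
Local Open Scope ring_scope.

(** Write <u, v> for the weighted integral of u v and
    B(u, v) = <u, v> <h, h> - <u, h> <v, h>. All four determinants in the
    theorem are values of the symmetric bilinear form B, so with A = B(f, f),
    C = B(g, g) and b = B(f, g) the quantity to estimate is
    D = sqrt A + sqrt C - sqrt (A + 2 b + C).

    The analytic input is a Chebyshev inequality, [chebyshev_gram]: 2 B(u, v) is
    the weighted double integral of
      (u(x) h(y) - u(y) h(x)) (v(x) h(y) - v(y) h(x)),
    which is h(x)^2 h(y)^2 times the product of the increments of u/h and v/h,
    and hence nonnegative when u/h and v/h are synchronous. Since u = v always
    satisfies the hypothesis, B is positive semidefinite and so obeys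
    Cauchy-Schwarz, b^2 <= A C ([gram_CS]). The choice
    u = M g - f, v = f - m g in the Chebyshev inequality yields
    A + m M C <= (M + m) b.

    What remains, [reverse_triangle_bound], is about real numbers.
    Cauchy-Schwarz gives D >= 0. For the upper bound,
      D^2 <= (sqrt A + sqrt C)^2 - (A + 2 b + C) = 2 (sqrt (A C) - b),
    and the arithmetic-geometric mean inequality
      2 sqrt (m M) sqrt (A C) <= A + m M C <= (M + m) b
    turns the right-hand side into at most
    (sqrt M - sqrt m)^2 / sqrt (m M) * b. *)

Lemma det22E (R : realType) (a b c d : R) : det22 a b c d = a * d - b * c.
Proof.
rewrite /det22 (expand_det_row _ ord0) !big_ord_recl big_ord0 /cofactor.
by rewrite !det_mx11 !mxE /= expr0 expr1; ring.
Qed.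

(** * Real-valued integrable functions *)

Section RealIntegrable.
Context {R : realType} {d : measure_display} {T : measurableType d}.
Context {mu : {measure set T -> \bar R}}.
Implicit Types F G : T -> R.

Lemma integrableD_EFin F G :
  mu.-integrable [set: T] (EFin \o F) -> mu.-integrable [set: T] (EFin \o G) ->
  mu.-integrable [set: T] (EFin \o (fun x => F x + G x)).
Proof.
by move=> iF iG; apply: eq_integrable (integrableD _ iF iG).
Qed.

Lemma integrableZl_EFin (c : R) F :
  mu.-integrable [set: T] (EFin \o F) ->
  mu.-integrable [set: T] (EFin \o (fun x => c * F x)).
Proof.
by move=> iF; apply: eq_integrable (integrableZl _ c iF).
Qed.

Lemma Rintegral_ae_ge0 F : mu.-integrable [set: T] (EFin \o F) ->
  {ae mu, forall x, 0 <= F x} -> 0 <= \int[mu]_(x in [set: T]) F x.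
Proof.
move=> /measurable_int mF F_ge0.
have -> : \int[mu]_(x in [set: T]) F x = \int[mu]_(x in [set: T]) `|F x|.
  congr fine; apply: ae_eq_integral => //.
    by apply/measurable_EFinP; apply: measurableT_comp => //; exact/measurable_EFinP.
  by apply: filterS F_ge0 => x Fx _ /=; rewrite ger0_norm.
by apply: Rintegral_ge0.
Qed.

End RealIntegrable.

(** * The Gram form relative to h on the weighted L2 space *)

Section WeightedL2.
Context {R : realType} {d : measure_display} {T : measurableType d}.
Context (mu : {measure set T -> \bar R}) (phi : T -> R).
Context (mphi : measurable_fun [set: T] phi) (phi_ge0 : forall x, 0 <= phi x).
Implicit Types u v w h : T -> R.

Let I := wint mu phi.
Let L2 := L2weight mu phi.

(** Pointwise |u v| <= u^2 + v^2. *)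
Lemma wint_integrable u v : L2 u -> L2 v ->
  mu.-integrable [set: T] (EFin \o (fun x => phi x * u x * v x)).
Proof.
move=> L2u L2v.
have sq w : L2 w ->
    mu.-integrable [set: T] (EFin \o (fun x => phi x * w x ^+ 2)).
  case=> mw w_fin; apply/integrableP; split.
    by apply/measurable_EFinP; apply: measurable_funM => //; apply: measurable_funX.
  rewrite (eq_integral (fun x => (phi x * `|w x| ^+ 2)%:E))// => x _ /=.
  by rewrite real_normK ?num_real// ger0_norm// mulr_ge0// sqr_ge0.
apply: le_integrable (integrableD_EFin (sq u L2u) (sq v L2v)) => //.
  apply/measurable_EFinP; apply: measurable_funM; last exact: L2v.1.
  by apply: measurable_funM => //; exact: L2u.1.
move=> x _ /=; rewrite lee_fin -mulrDr -mulrA !normrM ler_wpM2l//.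
rewrite -normrM (le_trans _ (ler_norm _))// ler_norml.
by move: (u x) (v x) => a b; apply/andP; split; nra.
Qed.

(** Expanding the square leaves products that [wint_integrable] covers. *)
Lemma L2weight_lincomb (a b : R) u v : L2 u -> L2 v ->
  L2 (fun x => a * u x + b * v x).
Proof.
move=> L2u L2v; split.
  apply: measurable_funD; apply: measurable_funM => //.
    exact: L2u.1.
  exact: L2v.1.
have iuv w z c : L2 w -> L2 z ->
    mu.-integrable [set: T] (EFin \o (fun x => c * (phi x * w x * z x))).
  by move=> L2w L2z; exact/integrableZl_EFin/wint_integrable.
have /(integrable_lty measurableT) := integrableD_EFin (iuv u u (a ^+ 2) L2u L2u)
  (integrableD_EFin (iuv u v (2 * a * b) L2u L2v) (iuv v v (b ^+ 2) L2v L2v)).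
congr (_ < _)%E; apply: eq_integral => x _ /=; congr EFin.
by rewrite real_normK ?num_real//; ring.
Qed.

Lemma wintC u v : I u v = I v u.
Proof. by apply: eq_Rintegral => x _; rewrite mulrAC. Qed.

Lemma wint_lincomb (a b : R) u v w : L2 u -> L2 v -> L2 w ->
  I (fun x => a * u x + b * v x) w = a * I u w + b * I v w.
Proof.
move=> L2u L2v L2w; have iu := wint_integrable L2u L2w.
have iv := wint_integrable L2v L2w.
rewrite /I /wint -!RintegralZl// -RintegralD//; try exact: integrableZl_EFin.
by apply: eq_Rintegral => x _; ring.
Qed.

Lemma wint_lincombr (a b : R) u v w : L2 u -> L2 v -> L2 w ->
  I w (fun x => a * u x + b * v x) = a * I w u + b * I w v.
Proof. by move=> *; rewrite wintC wint_lincomb// !(wintC w). Qed.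

(** Up to the factor <h, h>, the inner product of the components of u and v
    orthogonal to h. *)
Definition gram h u v := det22 (I u v) (I u h) (I v h) (I h h).

Lemma gramC h u v : gram h u v = gram h v u.
Proof. by rewrite /gram !det22E (wintC u v) [_ * I v h]mulrC. Qed.

Lemma gram_lincomb h (a b : R) u v w : L2 h -> L2 u -> L2 v -> L2 w ->
  gram h (fun x => a * u x + b * v x) w = a * gram h u w + b * gram h v w.
Proof.
by move=> L2h L2u L2v L2w; rewrite /gram !det22E !wint_lincomb//; ring.
Qed.

Lemma gram_lincomb2 h (a b a' b' : R) u v : L2 h -> L2 u -> L2 v ->
  gram h (fun x => a * u x + b * v x) (fun x => a' * u x + b' * v x) =
  a * a' * gram h u u + (a * b' + b * a') * gram h u v + b * b' * gram h v v.
Proof.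
move=> L2h L2u L2v; have L2w := L2weight_lincomb a' b' L2u L2v.
rewrite gram_lincomb// (gramC h u) (gramC h v) !gram_lincomb//.
by rewrite (gramC h v u); ring.
Qed.

(** The kernel is integrated one variable at a time, so that no Fubini theorem
    enters: for fixed x the integral over y is a
    combination of u x, v x and h x with constant coefficients, and this
    expression in x is then integrated in turn, giving twice the Gram determinant. *)
Lemma chebyshev_gram h u v : L2 h -> L2 u -> L2 v ->
  {ae mu, forall x, {ae mu, forall y,
    0 <= (u x * h y - u y * h x) * (v x * h y - v y * h x)}} ->
  0 <= gram h u v.
Proof.
move=> L2h L2u L2v sync.
(* The integral over y of the kernel is u x * k1 x + h x * k2 x. *)
pose k1 x := I h h * v x + - I v h * h x.
pose k2 x := I u v * h x + - I u h * v x.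
have L2k1 : L2 k1 by exact: L2weight_lincomb.
have L2k2 : L2 k2 by exact: L2weight_lincomb.
have inner : {ae mu, forall x, 0 <= phi x * u x * k1 x + phi x * h x * k2 x}.
  apply: filterS sync => x sync_x.
  have L2w w : L2 w -> L2 (fun y => w x * h y + - h x * w y).
    by move=> L2w; exact: L2weight_lincomb.
  have : 0 <= I (fun y => u x * h y + - h x * u y)
                (fun y => v x * h y + - h x * v y).
    apply: Rintegral_ae_ge0; first by apply: wint_integrable; exact: L2w.
    apply: filterS sync_x => y ?; rewrite -mulrA mulr_ge0//.
    by rewrite !mulNr ![h x * _]mulrC.
  rewrite wint_lincomb//; last exact: L2w.
  rewrite !wint_lincombr//.
  move=> /(mulr_ge0 (phi_ge0 x)); congr (0 <= _).
  by rewrite /k1 /k2 (wintC h v); ring.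
suff -> : gram h u v = (I u k1 + I h k2) / 2.
  rewrite divr_ge0// /I /wint -RintegralD//; try exact: wint_integrable.
  apply: Rintegral_ae_ge0 => //.
  by apply: integrableD_EFin; exact: wint_integrable.
rewrite /k1 /k2 /gram det22E !wint_lincombr//.
by rewrite (wintC h v); field.
Qed.

(** For u = v the Chebyshev kernel is a square, as in Lagrange's identity. *)
Lemma gram_ge0 h u : L2 h -> L2 u -> 0 <= gram h u u.
Proof.
move=> L2h L2u; apply: chebyshev_gram => //.
by apply: aeW => x; apply: aeW => y; rewrite -expr2 sqr_ge0.
Qed.

(** The discriminant argument for the value of the form at a u + b v. *)
Lemma gram_CS h u v : L2 h -> L2 u -> L2 v ->
  gram h u v ^+ 2 <= gram h u u * gram h v v.
Proof.
move=> L2h L2u L2v.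
have pos a b : 0 <= a ^+ 2 * gram h u u + 2 * a * b * gram h u v
                    + b ^+ 2 * gram h v v.
  have := gram_ge0 L2h (L2weight_lincomb a b L2u L2v).
  by rewrite gram_lincomb2//; congr (0 <= _); ring.
move: pos (gram_ge0 L2h L2u) (gram_ge0 L2h L2v).
move: (gram h u u) (gram h v v) (gram h u v) => A C B pos A_ge0 C_ge0.
(* When C = 0, the vector (B, -(A + 1)) forces B = 0; otherwise (C, -B) gives
   C (A C - B^2) >= 0. *)
have [C0|C_neq0] := eqVneq C 0.
  have := pos B (- (A + 1)); rewrite C0 !mulr0 addr0.
  have -> : B ^+ 2 * A + 2 * B * - (A + 1) * B = - (B ^+ 2 * (A + 2)) by ring.
  by rewrite oppr_ge0 pmulr_lle0// ltr_wpDl.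
have C_gt0 : 0 < C by rewrite lt_def C_neq0.
rewrite -subr_ge0 -(pmulr_rge0 _ C_gt0).
by have := pos C (- B); congr (0 <= _); ring.
Qed.

End WeightedL2.

(** * The triangle inequality defect *)

(** A, B, C stand for the values at (f, f), (f, g), (g, g) of a positive
    semidefinite form. The first inequality is then the triangle inequality for
    its seminorm; the second bounds the defect, because the last hypothesis
    bounds A C from above by a multiple of B^2, a reverse of Cauchy-Schwarz. *)
Lemma reverse_triangle_bound (R : realType) (m M A B C : R) :
  0 < m -> m < M -> 0 <= A -> 0 <= C -> B ^+ 2 <= A * C ->
  A + m * M * C <= (M + m) * B ->
  let D := Num.sqrt A + Num.sqrt C - Num.sqrt (A + 2 * B + C) in
  0 <= D /\
  D <= (Num.sqrt M - Num.sqrt m) / ((m * M) `^ (1 / 4)) * Num.sqrt B.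
Proof.
move=> m_gt0 ltmM A_ge0 C_ge0 BAC hB.
have M_gt0 : 0 < M by exact: lt_trans ltmM.
have B_ge0 : 0 <= B.
  rewrite -(pmulr_rge0 _ (addr_gt0 M_gt0 m_gt0)) (le_trans _ hB)//.
  by rewrite addr_ge0// !mulr_ge0// ltW.
set k := _ `^ _.
have k_gt0 : 0 < k by rewrite powR_gt0 ?mulr_gt0.
have k2 : k ^+ 2 = Num.sqrt m * Num.sqrt M.
  rewrite -powR_mulrn ?ltW// -powRrM (_ : 1 / 4 * 2%:R = 2^-1); last by field.
  by rewrite powR12_sqrt ?mulr_ge0 ?ltW// sqrtrM// ltW.
have S_ge0 : 0 <= A + 2 * B + C by rewrite !addr_ge0 ?mulr_ge0.
have r_lt_s : Num.sqrt m < Num.sqrt M by rewrite ltr_sqrt.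
have r_gt0 : 0 < Num.sqrt m by rewrite sqrtr_gt0.
move: (sqrtr_ge0 A) (sqrtr_ge0 C) (sqrtr_ge0 B) (sqrtr_ge0 (A + 2 * B + C)).
move: (sqr_sqrtr A_ge0) (sqr_sqrtr C_ge0) (sqr_sqrtr B_ge0) (sqr_sqrtr S_ge0).
move: (sqr_sqrtr (ltW m_gt0)) (sqr_sqrtr (ltW M_gt0)) r_lt_s r_gt0 k2.
move: (Num.sqrt A) (Num.sqrt B) (Num.sqrt C) (Num.sqrt m) (Num.sqrt M)
  (Num.sqrt (A + 2 * B + C)) => p b q r s t rE sE r_lt_s r_gt0 k2 pE qE bE tE
  p_ge0 q_ge0 b_ge0 t_ge0.
have B_le : B <= p * q.
  rewrite -(@ler_pXn2r _ 2) ?nnegrE ?mulr_ge0//.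
  by rewrite exprMn pE qE.
have t_le : t <= p + q.
  rewrite -(@ler_pXn2r _ 2) ?nnegrE ?addr_ge0// tE.
  have -> : (p + q) ^+ 2 = p ^+ 2 + 2 * (p * q) + q ^+ 2 by ring.
  by lra.
split; first by rewrite subr_ge0.
have s_gt0 : 0 < s by exact: lt_trans r_lt_s.
rewrite -(@ler_pXn2r _ 2) ?nnegrE ?subr_ge0//; last first.
  by rewrite mulr_ge0 ?divr_ge0 ?subr_ge0 ?(ltW r_lt_s) ?(ltW k_gt0).
(* As 0 <= t <= p + q, the square of p + q - t is at most (p + q)^2 - t^2. *)
have defect : (p + q - t) ^+ 2 <= 2 * (p * q - B).
  have -> : 2 * (p * q - B) = (p + q) ^+ 2 - t ^+ 2 by rewrite tE -pE -qE; ring.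
  have : 0 <= t * (p + q - t) by rewrite mulr_ge0// subr_ge0.
  by lra.
apply: le_trans defect _.
rewrite exprMn expr_div_n k2 bE mulrAC ler_pdivlMr ?mulr_gt0//.
have amgm : 2 * (r * s) * (p * q) <= (M + m) * B.
  (* The two terms of A + m M C are p^2 and (r s q)^2. *)
  apply: le_trans hB; rewrite -pE -qE -rE -sE.
  by have := sqr_ge0 (p - r * s * q); lra.
rewrite -rE -sE in amgm; lra.
Qed.

Theorem proposition3p4 (R : realType) (d : measure_display)
    (T : measurableType d) (mu : {measure set T -> \bar R})
    (phi : T -> R) (mphi : measurable_fun [set: T] phi)
    (phi_ge0 : forall x, 0 <= phi x)
    (m M : R) (m_gt0 : 0 < m) (ltmM : m < M)
    (f g h : T -> R)
    (L2f : L2weight mu phi f) (L2g : L2weight mu phi g)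
    (L2h : L2weight mu phi h)
    (h_neq0 : {ae mu, forall x, h x != 0})
    (sync : synchronous mu (fun x => M * (g x / h x) - f x / h x)
                           (fun x => f x / h x - m * (g x / h x))) :
  let I := wint mu phi in
  let D := Num.sqrt (det22 (I f f) (I f h)
                           (I f h) (I h h))
         + Num.sqrt (det22 (I g g) (I g h)
                           (I g h) (I h h))
         - Num.sqrt (det22 (I (f \+ g) (f \+ g)) (I (f \+ g) h)
                           (I (f \+ g) h)        (I h h)) in
  0 <= D /\
  D <= (Num.sqrt M - Num.sqrt m) / ((m * M) `^ (1 / 4))
       * Num.sqrt (det22 (I f g) (I f h)
                         (I g h) (I h h)).
Proof.
move=> I D.
pose G := gram mu phi h.
have GfgD : G (f \+ g) (f \+ g) = G f f + 2 * G f g + G g g.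
  have -> : f \+ g = fun x => 1 * f x + 1 * g x.
    by apply/funext => x; rewrite !mul1r.
  by rewrite /G gram_lincomb2//; ring.
(* Clearing the denominators h x and h y turns synchronicity of the quotients
   into the hypothesis of the Chebyshev inequality for u and v. *)
have cheb : G f f + m * M * G g g <= (M + m) * G f g.
  pose u x := -1 * f x + M * g x; pose v x := 1 * f x + - m * g x.
  have : 0 <= G u v.
    apply: chebyshev_gram => //; try exact: L2weight_lincomb.
    apply: filterS2 (h_neq0) (sync) => x hx.
    apply: filterS2 h_neq0 => y hy qp_ge0.
    have -> : (u x * h y - u y * h x) * (v x * h y - v y * h x) =
      (h x * h y) ^+ 2 * ((M * (g x / h x) - f x / h x
                            - (M * (g y / h y) - f y / h y))
                         * (f x / h x - m * (g x / h x)
                            - (f y / h y - m * (g y / h y)))).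
      by rewrite /u /v; field; rewrite hx hy.
    by rewrite mulr_ge0// sqr_ge0.
  by rewrite /G gram_lincomb2//; lra.
have := reverse_triangle_bound m_gt0 ltmM (gram_ge0 mphi phi_ge0 L2h L2f)
  (gram_ge0 mphi phi_ge0 L2h L2g) (gram_CS mphi phi_ge0 L2h L2f L2g) cheb.
by rewrite -GfgD.
Qed.
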